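(* For every positive integer $j$, let $n=27+F_{120j+17}$. Then $n,\ n+2,\ n+4,\ n+6,\ n+8$ is a sequence of five consecutive Zeckendorf-Niven terms in a $2$-AP; that is, each of $n,n+2,n+4,n+6,n+8$ is Zeckendorf-Niven.
   Context: Let $F_i$ be the Fibonacci numbers: $F_0=0$, $F_1=1$, $F_i=F_{i-1}+F_{i-2}$ for $i\ge 2$. By Zeckendorf's theorem, every positive integer $n$ has a unique sequence $(\zeta_i(n))_{i=2}^\infty$ with $\zeta_i(n)\in\{0,1\}$ and $\zeta_i(n)+\zeta_{i+1}(n)\le 1$ for all $i\ge 2$, such that $n=\sum_{i=2}^\infty \zeta_i(n)F_i$ (the Zeckendorf decomposition of $n$). Put $s_Z(n)=\sum_{i=2}^\infty\zeta_i(n)$. A positive integer $n$ is called Zeckendorf-Niven if $s_Z(n)$ divides $n$. A $2$-AP is an infinite arithmetic progression of positive integers with common difference $2$. *)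

(* Defs.v *)
From mathcomp Require Import all_boot.
Set Implicit Arguments.
Unset Strict Implicit.
Unset Printing Implicit Defensive.

Fixpoint fib (n : nat) : nat :=
  if n is m.+1 then if m is k.+1 then fib m + fib k else 1 else 0.

Arguments fib : simpl never.

Lemma fibSS n : fib n.+2 = fib n.+1 + fib n.
Proof. by []. Qed.

Lemma fib_gt0 n : 0 < n -> 0 < fib n.
Proof. by case: n => // n _; elim: n => // n IHn; rewrite fibSS addn_gt0 IHn. Qed.

(* The terms [f i], [i >= 2], are natural numbers, so the infinite sum
   [\sum_(i >= 2) f i] equals [n] iff its partial sums are eventually [n]. *)
Definition infinite_sum2 (f : nat -> nat) (n : nat) : Prop :=
  exists N, forall M, N <= M -> \sum_(2 <= i < M) f i = n.

(* The digits are indexed from 2; [z 0] and [z 1] are irrelevant. *)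
Definition is_zeckendorf (z : nat -> bool) (n : nat) : Prop :=
  (forall i, 2 <= i -> z i + z i.+1 <= 1) /\
  infinite_sum2 (fun i => z i * fib i) n.

Lemma zeckendorf_bounded k n : n < fib k.+1 ->
  {z : nat -> bool | [/\ forall i, z i + z i.+1 <= 1,
     forall i, k < i -> z i = false &
     \sum_(2 <= i < k.+1) z i * fib i = n]}.
Proof.
have [m] := ubnP k; elim: m k n => // m IHm [|[|k]] n.
- by case: n => // _ _; exists (fun=> false); split=> //; rewrite big_geq.
- by case: n => // _ _; exists (fun=> false); split=> //; rewrite big_geq.
rewrite ltnS => ltkm ltn; have [lt_n | le_n] := ltnP n (fib k.+2).
  have [|z [zz z0 zs]] := IHm k.+1 n _ lt_n; first by apply: leq_trans ltkm.
  exists z; split=> [//|i lti|]; first by apply: z0; apply: ltnW.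
  by rewrite big_nat_recr //= z0 // mul0n addn0.
have [||z [zz z0 zs]] := IHm k (n - fib k.+2).
- by apply: leq_trans ltkm; apply: leqnSn.
- by rewrite ltn_subLR // -fibSS.
exists (fun i => (i == k.+2) || z i); split=> [i|i lti|].
- have [->|neik] := eqVneq i k.+2.
    by rewrite gtn_eqF //= z0 // !ltnS leqW.
  have [[->]|//] := eqVneq i.+1 k.+2; last by rewrite /= zz.
  by rewrite /= z0.
- by rewrite gtn_eqF // z0 //; apply: ltn_trans lti; apply: leqnSn.
rewrite big_nat_recr //= eqxx mul1n.
rewrite [X in X + _](_ : _ = n - fib k.+2); last first.
  rewrite -zs; case: k z0 {ltkm ltn le_n zz zs} => [|k] z0; first by rewrite !big_geq.
  rewrite big_nat_recr //= ltn_eqF // z0 // mul0n addn0.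
  by apply: eq_big_nat => i /andP[_ lti]; rewrite ltn_eqF //; apply: ltnW.
by rewrite subnK.
Qed.

Lemma ltn_fibSS n : n < fib n.+2.
Proof.
elim: n => // n IHn; rewrite fibSS.
by rewrite -ltnS -[X in X < _]addn1 ltnS; apply: leq_add => //; apply: fib_gt0.
Qed.

Theorem zeckendorf_exists n : {z : nat -> bool | is_zeckendorf z n}.
Proof.
have [z [zz z0 zs]] := zeckendorf_bounded (ltn_fibSS n).
exists z; split=> [i _|]; first exact: zz.
exists n.+2 => M leM; rewrite (@big_cat_nat _ _ _ n.+2) //= zs.
by rewrite big_nat big1 ?addn0 // => i /andP[lti _]; rewrite z0.
Qed.

Lemma zeckendorf_partial_lt (z : nat -> bool) k :
  (forall i, 2 <= i -> z i + z i.+1 <= 1) ->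
  \sum_(2 <= i < k.+1) z i * fib i < fib k.+1.
Proof.
move=> zz; have [m] := ubnP k; elim: m k => // m IHm [|[|k]].
- by rewrite big_geq.
- by rewrite big_geq.
rewrite ltnS => ltkm; rewrite big_nat_recr //=.
case zk: (z k.+2); last first.
  rewrite mul0n addn0; apply: leq_trans (IHm k.+1 _) (leq_addr _ _).
  exact: leq_trans ltkm.
rewrite mul1n addnC fibSS ltn_add2l.
case: k zk ltkm => [|k] zk ltkm; first by rewrite big_geq.
rewrite big_nat_recr //=.
have := zz k.+2 isT; rewrite zk; case: (z k.+2) => // _.
rewrite mul0n addn0; apply: leq_trans (IHm k.+1 _) _ => //.
  by apply: leq_trans ltkm; rewrite ltnW.
Qed.

Theorem zeckendorf_unique n (z z' : nat -> bool) :
  is_zeckendorf z n -> is_zeckendorf z' n -> forall i, 2 <= i -> z i = z' i.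
Proof.
move=> [zz [N zN]] [zz' [N' zN']] i le2i.
have agree M : \sum_(2 <= i < M) z i * fib i = \sum_(2 <= i < M) z' i * fib i ->
    forall i, 2 <= i < M -> z i = z' i.
  elim: M => [_ j|M IHM]; first by rewrite ltn0 andbF.
  case: (leqP 2 M) => [le2M|ltM2 _ j /andP[le2j]]; last first.
    by rewrite ltnS => /(leq_trans le2j); rewrite leqNgt ltM2.
  have h (y : nat -> bool) : (forall i, 2 <= i -> y i + y i.+1 <= 1) ->
      \sum_(2 <= i < M) y i * fib i < fib M.
    by case: M le2M {IHM} => // M _; apply: zeckendorf_partial_lt.
  rewrite !big_nat_recr //= => eqs.
  have eM : z M = z' M.
    have := h _ zz; have := h _ zz'; move: eqs.
    case: (z M); case: (z' M) => //; rewrite mul1n mul0n addn0 => eqs.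
      by rewrite -eqs ltnNge leq_addl.
    by rewrite eqs => _; rewrite ltnNge leq_addl.
  move: eqs; rewrite eM => /addIn/IHM{}IHM j /andP[le2j].
  by rewrite ltnS leq_eqVlt => /predU1P[->//|ltj]; apply: IHM; rewrite le2j.
have eqs M : maxn N N' <= M ->
    \sum_(2 <= i < M) z i * fib i = \sum_(2 <= i < M) z' i * fib i.
  by rewrite geq_max => /andP[leN leN']; rewrite zN ?zN'.
have lei : 2 <= i < maxn i.+1 (maxn N N') by rewrite le2i leq_maxl.
exact: (agree _ (eqs _ (leq_maxr i.+1 (maxn N N'))) i lei).
Qed.

Definition zeta (n i : nat) : bool := sval (zeckendorf_exists n) i.

Lemma zetaP n : is_zeckendorf (zeta n) n.
Proof. exact: (svalP (zeckendorf_exists n)). Qed.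

Lemma zeta_eq0 n i : n.+2 <= i -> zeta n i = false.
Proof.
move=> lei; apply/negP => zi; have [_ [N zN]] := zetaP n.
pose M := maxn N i.+1.
have ltiM : i < M by rewrite leq_max leqnn orbT.
have := zN M (leq_maxl _ _); rewrite (bigD1_seq i) /= ?iota_uniq //; last first.
  by rewrite mem_index_iota ltiM (leq_trans _ lei).
rewrite zi mul1n => en; have : fib i <= n by rewrite -[X in _ <= X]en leq_addr.
rewrite leqNgt => /negP; apply; apply: leq_trans (_ : i.-1 <= _).
  by case: i lei {zi ltiM en M}.
by case: i lei {zi ltiM en M} => [|[|i]] // _; apply: ltn_fibSS.
Qed.

(* By [s_ZP] below, [s_Z n] is the sum of the infinite series [zeta n]:
   all digits of index at least [n + 2] vanish. *)
Definition s_Z (n : nat) : nat := \sum_(2 <= i < n.+2) zeta n i.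

Lemma s_ZP n : infinite_sum2 (fun i => zeta n i) (s_Z n).
Proof.
exists n.+2 => M leM; rewrite (@big_cat_nat _ _ _ n.+2) //= [X in _ + X]big_nat.
by rewrite [X in _ + X]big1 ?addn0 // => i /andP[lti _]; rewrite zeta_eq0.
Qed.

Definition zeckendorf_niven (n : nat) : Prop := 0 < n /\ s_Z n %| n.

(* Main.v *)
Require Import Defs.
From mathcomp Require Import all_boot.

(** If [m < F_(k-1)], then adding the term [F_k] to the Zeckendorf decomposition
    of [m] gives that of [m + F_k].  Hence, for a large Fibonacci number [F],
    the digit sums of [27 + F], [29 + F], [31 + F], [33 + F] and [35 + F] are
    4, 3, 4, 5 and 3.  The Pisano periods of 3, 4 and 5 are 8, 6 and 20, all of
    which divide 120, so [F_(120 j + 17)] is congruent to [F_17 = 1597] modulo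
    3, 4 and 5. *)

Lemma leq_fib : {homo fib : m n / m <= n}.
Proof.
apply: homo_leq => [//|m n p|[|n]] //; first exact: leq_trans.
by rewrite fibSS leq_addr.
Qed.

(** Two consecutive residues determine all later ones, so the induction carries the congruences at
    [n] and [n.+1] together. *)
Lemma fib_add_period d p n : fib p = 0 %[mod d] -> fib p.+1 = 1 %[mod d] ->
  fib (p + n) = fib n %[mod d].
Proof.
move=> fp0 fp1.
suff [] : fib (p + n) = fib n %[mod d] /\ fib (p + n.+1) = fib n.+1 %[mod d].
  by [].
elim: n => [|n [IH0 IH1]]; first by rewrite addn0 addn1.
split=> //; rewrite addnS addnS !fibSS -[(p + n).+1]addnS.
by rewrite -modnDm IH1 IH0 modnDm.
Qed.

Lemma fib_add_mul_period d p q n :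
  fib p = 0 %[mod d] -> fib p.+1 = 1 %[mod d] ->
  fib (p * q + n) = fib n %[mod d].
Proof.
move=> fp0 fp1; elim: q => [|q IHq]; first by rewrite muln0.
by rewrite mulnS -addnA fib_add_period.
Qed.

Lemma eq_infinite_sum2 f g m :
  (forall i, f i = g i) -> infinite_sum2 f m -> infinite_sum2 g m.
Proof.
by move=> fg [N fN]; exists N => M /fN <-; apply: eq_bigr => i _; rewrite fg.
Qed.

Lemma infinite_sum2D f g m n : infinite_sum2 f m -> infinite_sum2 g n ->
  infinite_sum2 (fun i => f i + g i) (m + n).
Proof.
move=> [N fN] [N' gN']; exists (maxn N N') => M.
by rewrite geq_max big_split /= => /andP[/fN -> /gN' ->].
Qed.

Lemma infinite_sum2_delta f k :
  1 < k -> infinite_sum2 (fun i => (i == k) * f i) (f k).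
Proof.
move=> k1; exists k.+1 => M ltkM.
rewrite (bigD1_seq k) ?iota_uniq ?mem_index_iota ?k1 //= eqxx mul1n.
by rewrite big1 ?addn0 // => i /negPf->.
Qed.

Lemma infinite_sum2_term_le f n i : 1 < i -> infinite_sum2 f n -> f i <= n.
Proof.
move=> i1 [N fN]; rewrite -(fN (maxn N i.+1)) ?leq_maxl //.
rewrite (bigD1_seq i) ?iota_uniq ?leq_addr //=.
by rewrite mem_index_iota i1 leq_max leqnn orbT.
Qed.

Lemma zeta_fib_gt n i : 1 < i -> n < fib i -> zeta n i = false.
Proof.
move=> i1 lt_n; have [_ zs] := zetaP n.
have := infinite_sum2_term_le _ _ _ i1 zs.
by case: zeta; rewrite // mul1n leqNgt lt_n.
Qed.

(** By uniqueness, any exhibited Zeckendorf digits of [n] compute [s_Z n]. *)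
Lemma s_Z_eq z n s :
  is_zeckendorf z n -> infinite_sum2 (fun i => z i) s -> s_Z n = s.
Proof.
move=> zz [N zN]; have [N' zN'] := s_ZP n.
rewrite -(zN (maxn N N')) ?leq_maxl // -(zN' (maxn N N')) ?leq_maxr //.
apply: eq_big_nat => i /andP[i1 _].
by rewrite (zeckendorf_unique (zetaP n) zz).
Qed.

Lemma s_Z0 : s_Z 0 = 0.
Proof. by rewrite /s_Z big_geq. Qed.

Lemma s_Z_add_fib m k : m < fib k -> s_Z (m + fib k.+1) = (s_Z m).+1.
Proof.
case: k => // k lt_m.
have z0 i : 1 < i -> k < i -> zeta m i = false.
  move=> i1 ltki; apply: zeta_fib_gt => //.
  exact: leq_trans lt_m (leq_fib _ _ ltki).
pose z i := (i == k.+2) || zeta m i.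
(* The two digit sets are disjoint, so the disjunction is a sum and both series can be added
   termwise. *)
have zE i : (i == k.+2) + zeta m i = z i.
  by rewrite /z; case: eqP => [->|//]; rewrite z0.
have [zz zs] := zetaP m.
apply: (@s_Z_eq z); last first.
  apply: eq_infinite_sum2 zE _; rewrite -[(s_Z m).+1]add1n.
  apply: infinite_sum2D (s_ZP m).
  apply: eq_infinite_sum2 (infinite_sum2_delta (fun=> 1) k.+2 isT) => i.
  by rewrite muln1.
split=> [i i1|]; last first.
  apply: (@eq_infinite_sum2 (fun i => (i == k.+2) * fib i + zeta m i * fib i)).
    by move=> i; rewrite -mulnDl zE.
  by rewrite addnC; apply: infinite_sum2D zs; apply: infinite_sum2_delta.
(* Only the neighbours [k.+3] and [k.+1] of the new digit matter; both exceed [k], so [z0]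
   applies. *)
rewrite /z; have [->|_] := eqVneq i k.+2.
  by rewrite gtn_eqF //= z0 // ltnW.
have [ei|_] := eqVneq i.+1 k.+2; last exact: zz.
by case: ei i1 => -> k0; rewrite z0.
Qed.

Theorem theorem4p4 (j : nat) (hj : 0 < j) :
  let n := 27 + fib (120 * j + 17) in
  [/\ zeckendorf_niven n, zeckendorf_niven (n + 2), zeckendorf_niven (n + 4),
      zeckendorf_niven (n + 6) & zeckendorf_niven (n + 8)].
Proof.
move=> n.
have f3 : fib (120 * j + 17) = 1 %[mod 3].
  by rewrite -[120]/(8 * 15) -mulnA fib_add_mul_period.
have f4 : fib (120 * j + 17) = 1 %[mod 4].
  by rewrite -[120]/(6 * 20) -mulnA fib_add_mul_period.
have f5 : fib (120 * j + 17) = 2 %[mod 5].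
  by rewrite -[120]/(20 * 6) -mulnA fib_add_mul_period.
(* [fib 10 = 55] is the first Fibonacci number above 35, and 10 is at most [120 * j + 16]. *)
have niven a d : 0 < a -> a < fib 10 -> (s_Z a).+1 = d ->
    a + fib (120 * j + 17) = 0 %[mod d] ->
    zeckendorf_niven (a + fib (120 * j + 17)).
  move=> a0 lt_a sa da; split; first by rewrite addn_gt0 a0.
  rewrite addnS s_Z_add_fib ?sa -?addnS /dvdn ?da ?mod0n //.
  by apply: leq_trans lt_a (leq_fib _ _ _); rewrite (leq_trans _ (leq_addl _ _)).
(* Terms are added in increasing order, so that each partial sum satisfies the bound of
   [s_Z_add_fib]. *)
have s27 : s_Z 27 = 3.
  by rewrite -[27]/(0 + fib 2 + fib 5 + fib 8) !s_Z_add_fib ?s_Z0.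
have s29 : s_Z 29 = 2 by rewrite -[29]/(0 + fib 6 + fib 8) !s_Z_add_fib ?s_Z0.
have s31 : s_Z 31 = 3.
  by rewrite -[31]/(0 + fib 3 + fib 6 + fib 8) !s_Z_add_fib ?s_Z0.
have s33 : s_Z 33 = 4.
  by rewrite -[33]/(0 + fib 2 + fib 4 + fib 6 + fib 8) !s_Z_add_fib ?s_Z0.
have s35 : s_Z 35 = 2 by rewrite -[35]/(0 + fib 2 + fib 9) !s_Z_add_fib ?s_Z0.
(* With the residues above, the divisibilities reduce to 4 | 28, 3 | 30, 4 | 32, 5 | 35 and 3 |
   36. *)
rewrite /n; split.
- by apply: (niven 27 4); rewrite ?s27 // -modnDmr f4.
- by rewrite addnAC; apply: (niven 29 3); rewrite ?s29 // -modnDmr f3.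
- by rewrite addnAC; apply: (niven 31 4); rewrite ?s31 // -modnDmr f4.
- by rewrite addnAC; apply: (niven 33 5); rewrite ?s33 // -modnDmr f5.
- by rewrite addnAC; apply: (niven 35 3); rewrite ?s35 // -modnDmr f3.
Qed.
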